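(* Let $A\in\mathbb{Z}^{d\times n}$ be an integer matrix with columns $a_1,\dots,a_n$ such that there exists $c\in\mathbb{Q}^d$ with $c\cdot a_i>0$ for $i=1,\dots,n$. With $Q$, $K$, $Q_{\rm sat}$, $H$, $S$, $\bar S$ and $\min(S;S)$ as defined in the context, the following statements are equivalent: 1. $\min(S;S)$ is finite. 2. $\mathrm{cone}(S)$ is a rational polyhedral cone. 3. There is some $s\in S$ on every extreme ray of $K$. 4. $H$ is finite. 5. $\bar S$ is finite.
   Context: $\mathbb{N}=\mathbb{Z}_+=\{0,1,2,\dots\}$ and $\cdot$ is the standard inner product. For columns $a_1,\dots,a_n\in\mathbb{Z}^d$ of $A$: $Q=\{\sum_{i=1}^n x_i a_i : x_i\in\mathbb{N}\}$ is the semigroup they generate, $K=\{\sum_{i=1}^n x_i a_i: x_i\in\mathbb{R}_{\ge 0}\}$ is the cone they generate, $L=\{\sum_{i=1}^n x_i a_i: x_i\in\mathbb{Z}\}$ is the lattice they generate, and $Q_{\rm sat}=K\cap L$ is the saturation of $Q$. $H=Q_{\rm sat}\setminus Q$ is the set of holes, $S=\{a\in Q: a+Q_{\rm sat}\subset Q\}$ is the set of saturation points, and $\bar S=Q\setminus S$ is the set of non-saturation points. An element $a\in S$ is an $S$-minimal saturation point if there is no $b\in S$, $b\ne a$, with $a-b\in S$; equivalently $\{a-s: s\in S\cup\{0\}\}\cap S=\{a\}$. $\min(S;S)$ is the set of all $S$-minimal saturation points. $\mathrm{cone}(S)$ is the set of finite nonnegative real linear combinations of elements of $S$. A rational polyhedral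 cone is a closed cone defined by (finitely many) rational linear weak inequalities. *)

(* Defs.v *)
From mathcomp Require Import all_boot all_order all_algebra.
From mathcomp Require Import boolp classical_sets functions cardinality reals.

Set Implicit Arguments.
Unset Strict Implicit.
Unset Printing Implicit Defensive.

Import Order.TTheory GRing.Theory Num.Theory.
Local Open Scope classical_set_scope.
Local Open Scope ring_scope.

Section Cones.
Variables (R : realType) (d : nat).
Implicit Types (C X : set 'cV[R]_d) (v : 'cV[R]_d).

Definition ratdot (c : 'cV[rat]_d) (a : 'cV[int]_d) : rat :=
  \sum_i c i 0 * (a i 0)%:~R.

Definition embed (a : 'cV[int]_d) : 'cV[R]_d := map_mx intr a.

(* The case [m = 0] puts the origin in [cone X], even when [X] is empty. *)
Definition cone X : set 'cV[R]_d :=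
  [set y | exists (m : nat) (x : 'I_m -> 'cV[R]_d) (t : 'I_m -> R),
    [/\ forall i, X (x i), forall i, 0 <= t i & y = \sum_i t i *: x i]].

(* Weak inequalities make the set closed, and their homogeneity makes it a
   cone. *)
Definition rational_polyhedral_cone C : Prop :=
  exists (m : nat) (B : 'M[rat]_(m, d)),
    C = [set y : 'cV[R]_d | forall i, 0 <= \sum_j ratr (B i j) * y j 0].

Definition ray v : set 'cV[R]_d := [set t *: v | t in [set t : R | 0 <= t]].

(* An extreme ray is a one-dimensional face. *)
Definition extreme_ray C (r : set 'cV[R]_d) : Prop :=
  [/\ exists2 v : 'cV[R]_d, v != 0 & r = ray v,
      r `<=` C &
      forall x y, C x -> C y -> r (x + y) -> r x /\ r y].

End Cones.

Arguments embed R {d} a.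

Section Semigroup.
Variables (R : realType) (d n : nat) (A : 'M[int]_(d, n)).

Definition semigroup : set 'cV[int]_d :=
  [set a | exists x : 'I_n -> nat, a = \sum_i col i A *+ x i].

Definition lattice : set 'cV[int]_d :=
  [set a | exists x : 'I_n -> int, a = \sum_i col i A *~ x i].

Definition gen_cone : set 'cV[R]_d :=
  [set y | exists2 x : 'I_n -> R,
     forall i, 0 <= x i & y = \sum_i x i *: embed R (col i A)].

Definition saturation : set 'cV[int]_d :=
  [set a | gen_cone (embed R a) /\ lattice a].

Definition holes : set 'cV[int]_d := saturation `\` semigroup.

Definition sat_points : set 'cV[int]_d :=
  [set a | semigroup a /\ [set a + b | b in saturation] `<=` semigroup].

Definition nonsat_points : set 'cV[int]_d := semigroup `\` sat_points.

Definition min_sat_points : set 'cV[int]_d :=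
  [set a | sat_points a /\
     ~ exists b, [/\ sat_points b, b != a & sat_points (a - b)]].

End Semigroup.

Arguments gen_cone R {d n} A _.

(* Main.v *)
(* If [s] is a saturation point, then so is [s + m a_i] for every [m]; hence the
   weak inequalities defining a closed [cone S] hold at every [a_i], so that
   [cone S = K], and an extreme ray of [K] must carry one of the points of [S]
   that generate it.  If there are nonzero saturation points [s_j] on all the
   extreme rays, then they generate [K], and a hole cannot have a coefficient
   greater than [1] on any [s_j], since [s_j + Qsat] is contained in [Q]; so the
   holes lie in a zonotope.  A non-saturation point is a hole minus an element
   of [Qsat], so its height is bounded by that of a hole.  If there are only
   finitely many non-saturation points, then some multiple [m_i a_i] is in [S]
   for each [i], and an S-minimal point with a large coefficient on [a_i] is
   [m_i a_i] plus zero or a non-saturation point.  Finally [S] is contained in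
   the cone over its minimal points unless [0] is in [S], in which case
   [cone S = K]; so finiteness of the minimal points makes [cone S] polyhedral
   by Weyl's theorem, that is, by Fourier-Motzkin elimination. *)
Require Import Defs.
From HB Require Import structures.
From mathcomp Require Import all_boot all_order all_algebra.
From mathcomp Require Import boolp classical_sets functions cardinality reals.
From mathcomp Require Import lra zify.

Set Implicit Arguments.
Unset Strict Implicit.
Unset Printing Implicit Defensive.

Import Order.TTheory GRing.Theory Num.Theory.
Local Open Scope classical_set_scope.
Local Open Scope ring_scope.

(** * Convex cones and their generators *)

Section ConvexCones.
Variables (R : realType) (d : nat).
Implicit Types (C X : set 'cV[R]_d) (y : 'cV[R]_d) (a : 'cV[int]_d).

Fact embed_is_zmod_morphism : zmod_morphism (@embed R d).
Proof. by move=> a b; rewrite /embed raddfB. Qed.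
HB.instance Definition _ :=
  GRing.isZmodMorphism.Build _ _ (@embed R d) embed_is_zmod_morphism.

Lemma embed_inj : injective (@embed R d).
Proof.
move=> a b /matrixP e; apply/matrixP => i j.
by have := e i j; rewrite !mxE => /intr_inj.
Qed.

Lemma embed_eq0 a : (embed R a == 0) = (a == 0).
Proof. by rewrite -(raddf0 (@embed R d)) (inj_eq embed_inj). Qed.

Definition dot (w y : 'cV[R]_d) : R := \sum_j w j 0 * y j 0.

Fact dot_is_linear w : scalar (dot w).
Proof.
move=> t x y; rewrite /dot mulr_sumr -big_split /=.
by apply: eq_bigr => j _; rewrite !mxE mulrDr mulrCA.
Qed.
HB.instance Definition _ w :=
  GRing.isLinear.Build R 'cV[R]_d R *%R (dot w) (dot_is_linear w).

Lemma dotC w y : dot w y = dot y w.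
Proof. by apply: eq_bigr => j _; rewrite mulrC. Qed.

Definition rat_embed (b : 'cV[rat]_d) : 'cV[R]_d := map_mx ratr b.

Lemma dot_rat_embed b a : dot (rat_embed b) (embed R a) = ratr (ratdot b a).
Proof.
rewrite /dot /ratdot rmorph_sum /=; apply: eq_bigr => j _.
by rewrite !mxE rmorphM /= ratr_int.
Qed.

Definition convex_cone C : Prop :=
  [/\ C 0, forall x y, C x -> C y -> C (x + y) &
      forall t y, 0 <= t -> C y -> C (t *: y)].

Lemma convex_cone_sum C (I : finType) (P : pred I) (f : I -> 'cV[R]_d) :
  convex_cone C -> (forall i, P i -> C (f i)) -> C (\sum_(i | P i) f i).
Proof. by case=> C0 CD _; apply: big_ind. Qed.

Lemma cone_min C X : convex_cone C -> X `<=` C -> cone X `<=` C.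
Proof.
move=> cC XC y [m [x [t [Xx t0 ->]]]]; apply: convex_cone_sum => // i _.
by case: cC => _ _; apply; [exact: t0 | exact/XC/Xx].
Qed.

Lemma convex_cone_cone X : convex_cone (cone X).
Proof.
split.
- by exists 0, (fun=> 0), (fun=> 0); split; [case | case | rewrite big_ord0].
- move=> _ _ [m [x [t [Xx t0 ->]]]] [m' [x' [t' [Xx' t0' ->]]]].
  exists (m + m')%N, (fun i : 'I_(m + m') =>
    match fintype.split i with inl j => x j | inr j => x' j end).
  exists (fun i : 'I_(m + m') =>
    match fintype.split i with inl j => t j | inr j => t' j end).
  split; [by move=> i; case: fintype.split | by move=> i; case: fintype.split |].
  rewrite big_split_ord /=; congr +%R; apply: eq_bigr => i _.
    by rewrite -[lshift _ i]/(unsplit (inl i)) unsplitK.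
  by rewrite -[rshift _ i]/(unsplit (inr i)) unsplitK.
- move=> u _ u0 [m [x [t [Xx t0 ->]]]]; exists m, x, (fun i => u * t i).
  split=> // [i|]; first exact: mulr_ge0.
  by rewrite scaler_sumr; apply: eq_bigr => i _; rewrite scalerA.
Qed.

Lemma sub_cone X : X `<=` cone X.
Proof.
move=> y Xy; exists 1, (fun=> y), (fun=> 1); split=> //.
by rewrite big_ord1 scale1r.
Qed.

Lemma cone_eq X Y :
  X `<=` cone Y -> Y `<=` cone X -> cone X = cone Y.
Proof.
by move=> XY YX; apply/seteqP; split; apply: cone_min => //;
  exact: convex_cone_cone.
Qed.

(** The quantifier over [t] is the one that elimination removes, so this drives the induction on
    generators. For the forward direction, the right-hand side describes a convex cone containing
    [v] and [X]. *)
Lemma cone_setU1 X v y :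
  cone (v |` X) y <-> exists2 t, 0 <= t & cone X (y - t *: v).
Proof.
have cC := convex_cone_cone (v |` X); have [C0 CD CZ] := cC.
have cX := convex_cone_cone X; have [X0 XD XZ] := cX.
split; last first.
  move=> [t t0 Xy]; rewrite -(subrK (t *: v) y); apply: CD.
    by apply: cone_min Xy => // x Xx; apply: sub_cone; right.
  by apply: CZ => //; apply: sub_cone; left.
apply: (@cone_min [set y | exists2 t, 0 <= t & cone X (y - t *: v)]).
  split.
  - by exists 0; rewrite // scale0r subr0.
  - move=> x z [t t0 Xx] [u u0 Xz]; exists (t + u); first exact: addr_ge0.
    by rewrite scalerDl opprD addrACA; apply: XD.
  - move=> t x t0 [u u0 Xx]; exists (t * u); first exact: mulr_ge0.
    by rewrite -scalerA -scalerBr; apply: XZ.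
move=> x [->|Xx]; first by exists 1; rewrite // scale1r subrr.
by exists 0 => //; rewrite scale0r subr0; apply: sub_cone.
Qed.

(** * Weyl's theorem by Fourier-Motzkin elimination *)

Definition halfspaces (bs : seq 'cV[rat]_d) : set 'cV[R]_d :=
  [set y | forall b, b \in bs -> 0 <= dot (rat_embed b) y].

(** A list of normals suits elimination, which filters and pairs them; this recovers the matrix
    form. *)
Lemma halfspaces_polyhedral bs : rational_polyhedral_cone (halfspaces bs).
Proof.
exists (size bs), (\matrix_(i, j) (nth 0 bs i) j 0).
have E (i : 'I_(size bs)) y : dot (rat_embed (nth 0 bs i)) y =
    \sum_j ratr ((\matrix_(i, j) (nth 0 bs i) j 0) i j) * y j 0.
  by apply: eq_bigr => j _; rewrite !mxE.
apply/seteqP; split=> y /= Hy.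
  by move=> i; rewrite -E; apply/Hy/mem_nth.
by move=> b /(nthP 0)[i ib <-]; rewrite (E (Ordinal ib)).
Qed.

(* Fourier-Motzkin elimination of [t] from [b . (y - t g) >= 0]. *)
Definition eliminate (g : 'cV[int]_d) (bs : seq 'cV[rat]_d) :=
  [seq b <- bs | 0 <= ratdot b g] ++
  [seq ratdot b' g *: b - ratdot b g *: b' |
     b <- [seq b <- bs | ratdot b g < 0], b' <- [seq b <- bs | 0 < ratdot b g]].

Lemma dot_combine (p q : rat) b b' y :
  dot (rat_embed (p *: b - q *: b')) y =
  ratr p * dot (rat_embed b) y - ratr q * dot (rat_embed b') y.
Proof.
rewrite /dot !mulr_sumr -sumrB; apply: eq_bigr => j _.
by rewrite !mxE rmorphB !rmorphM /= mulrBl !mulrA.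
Qed.

(** A normal negative on [g] bounds [t] from below, and one positive on [g] bounds it from above. A
    suitable [t] exists exactly when neither [0] nor any lower bound exceeds an upper bound, and the
    normals vanishing on [g] are nonnegative at [y]. *)
Lemma halfspaces_eliminate g bs y :
  halfspaces (eliminate g bs) y <->
  exists2 t, 0 <= t & halfspaces bs (y - t *: embed R g).
Proof.
have dotB b t : dot (rat_embed b) (y - t *: embed R g) =
    dot (rat_embed b) y - t * ratr (ratdot b g).
  by rewrite linearB linearZ /= dot_rat_embed.
split=> [Hy|[t t0 Hy]].
  pose lower b := dot (rat_embed b) y / ratr (ratdot b g).
  (* The largest lower bound; the default [0] secures [0 <= t]. *)
  exists (\big[Order.max/0]_(b <- bs | ratdot b g < 0) lower b).
    exact: bigmax_ge_id.
  move=> b bbs; rewrite dotB subr_ge0.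
  have [bneg|bpos|b0] := ltgtP (ratdot b g) 0.
  - rewrite -ler_ndivrMr ?ltrq0 //.
    exact: (le_bigmax_seq _ b (fun b => ratdot b g < 0) lower).
  - rewrite -ler_pdivlMr ?ltr0q // big_seq_cond.
    apply: bigmax_le => [|b' /andP[b'bs b'neg]].
      rewrite divr_ge0 ?ler0q ?(ltW bpos) //; apply: Hy.
      by rewrite mem_cat mem_filter (ltW bpos) bbs.
    have /Hy : ratdot b g *: b' - ratdot b' g *: b \in eliminate g bs.
      rewrite mem_cat; apply/orP; right; apply/allpairsP; exists (b', b) => /=.
      by rewrite !mem_filter b'neg b'bs bpos bbs.
    rewrite dot_combine subr_ge0 => Hb.
    rewrite /lower ler_pdivlMr ?ltr0q // mulrAC ler_ndivrMr ?ltrq0 //.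
    by rewrite mulrC [X in _ <= X]mulrC.
  - rewrite b0 raddf0 mulr0; apply: Hy.
    by rewrite mem_cat mem_filter b0 lexx bbs.
move=> b; rewrite mem_cat => /orP[|/allpairsP[[c c'] /= []]].
  rewrite mem_filter => /andP[b0 bbs].
  have := Hy _ bbs; rewrite dotB subr_ge0; apply: le_trans.
  by rewrite mulr_ge0 // ler0q.
rewrite !mem_filter => /andP[c0 cbs] /andP[c'0 c'bs] ->.
have := Hy _ c'bs; have := Hy _ cbs; rewrite !dotB dot_combine !subr_ge0.
move: c0 c'0; rewrite -(ltrq0 R) -(ltr0q R) => c0 c'0.
(* These multipliers make the two terms in [t] equal, so they cancel. *)
move=> /(ler_wpM2l (ltW c'0)) ge_c /(ler_wnM2l (ltW c0)) ge_c'; lra.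
Qed.

(** Induction on the generators: each new one brings a nonnegative coefficient, which elimination
    projects out. *)
Lemma halfspaces_cone (gs : seq 'cV[int]_d) :
  exists bs, cone (embed R @` [set` gs]) = halfspaces bs.
Proof.
elim: gs => [|g gs [bs IH]].
  (* With no generators the cone is the origin, cut out by both signs of every coordinate. *)
  exists ([seq delta_mx j 0 | j : 'I_d] ++ [seq - delta_mx j 0 | j : 'I_d]).
  have E j y : dot (rat_embed (delta_mx j 0)) y = y j 0.
    rewrite /dot (bigD1 j) //= !mxE !eqxx rmorph1 mul1r big1 ?addr0 // => k kj.
    by rewrite !mxE (negbTE kj) rmorph0 mul0r.
  have E' j y : dot (rat_embed (- delta_mx j 0)) y = - y j 0.
    by rewrite -E -sub0r -[0 in LHS](scale0r (delta_mx j 0)) -[X in _ - X]scale1r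
      dot_combine rmorph0 rmorph1 mul0r sub0r mul1r.
  apply/seteqP; split=> y.
    have cone0 : convex_cone [set 0 : 'cV[R]_d].
      by split=> [|x z -> ->|t x _ ->]; rewrite /= ?addr0 ?scaler0.
    move=> /(cone_min cone0)-> //; last by move=> x [].
    by move=> b _; rewrite raddf0.
  move=> Hy; suff -> : y = 0 by case: (convex_cone_cone (embed R @` [set` [::]])).
  apply/matrixP => j k; rewrite ord1 mxE; apply/eqP; rewrite eq_le -oppr_ge0.
  rewrite -E' -E !Hy // mem_cat; apply/orP; [left|right]; apply/mapP; exists j;
    by rewrite ?mem_enum.
exists (eliminate g bs); apply/seteqP.
suff H y : cone (embed R @` [set` g :: gs]) y <-> halfspaces (eliminate g bs) y.
  by split=> y /H.
have -> : embed R @` [set` g :: gs] = embed R g |` embed R @` [set` gs].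
  rewrite -image_set1 -image_setU; congr image; apply/seteqP; split=> a /=.
    by rewrite inE => /predU1P.
  by move=> ?; rewrite inE; apply/predU1P.
rewrite cone_setU1 halfspaces_eliminate IH; split=> [] [t t0 Ht]; by exists t.
Qed.

Lemma finitely_generated_cone_polyhedral (gs : seq 'cV[int]_d) :
  rational_polyhedral_cone (cone (embed R @` [set` gs])).
Proof.
have [bs ->] := halfspaces_cone gs; exact: halfspaces_polyhedral.
Qed.

End ConvexCones.

(** * Finite sets of integer vectors *)

Section FinitenessOfIntegerPoints.
Variable d : nat.

Lemma finite_bounded_vectors (N : nat) :
  finite_set [set a : 'cV[int]_d | forall j, `|a j 0| <= N%:Z].
Proof.
(* Shifting by [N] identifies the integers from [-N] to [N] with the ordinals below [2N + 1]. *)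
pose f (v : 'cV['I_(N + N).+1]_d) : 'cV[int]_d := \col_j ((v j 0)%:Z - N%:Z).
apply: (@sub_finite_set _ _ (range f)); last exact: finite_image.
move=> a Ha; exists (\col_j inord (absz (a j 0%R + N%:Z))) => //.
apply/matrixP => j k; rewrite ord1 !mxE; have := Ha j.
by move=> Haj; rewrite inordK; lia.
Qed.

Lemma finite_combinations (n : nat) (A : 'M[int]_(d, n)) (N : nat) :
  finite_set [set a : 'cV[int]_d | exists2 x : 'I_n -> nat,
    forall i, (x i < N)%N & a = \sum_i col i A *+ x i].
Proof.
pose f (v : {ffun 'I_n -> 'I_N}) : 'cV[int]_d := \sum_i col i A *+ v i.
apply: (@sub_finite_set _ _ (range f)); last exact: finite_image.
move=> a [x xN ->]; exists [ffun i => Ordinal (xN i)] => //.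
by apply: eq_bigr => i _; rewrite ffunE.
Qed.

(** A zonotope is bounded: with coefficients at most [1], no coordinate exceeds in absolute value
    the sum [N] of the absolute values of all entries of the generators. *)
Lemma finite_zonotope (R : realType) (n : nat) (s : 'I_n -> 'cV[int]_d) :
  finite_set [set a : 'cV[int]_d | exists2 x : 'I_n -> R,
    forall i, 0 <= x i <= 1 & embed R a = \sum_i x i *: embed R (s i)].
Proof.
pose N := (\sum_i \sum_j absz (s i j 0%R))%N.
apply: (sub_finite_set _ (finite_bounded_vectors N)) => a [x x01 /matrixP ea] j.
have := ea j 0; rewrite mxE summxE => eaj.
rewrite -(ler_int R) intr_norm eaj (le_trans (ler_norm_sum _ _ _)) //.
rewrite -pmulrn natr_sum; apply: ler_sum => i _.
have /andP[xi0 xi1] := x01 i.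
rewrite !mxE normrM (ger0_norm xi0) -intr_norm -abszE -pmulrn.
apply: (@le_trans _ _ (absz (s i j 0%R))%:R); first exact: ler_piMl.
by rewrite ler_nat (bigD1 j) //= leq_addr.
Qed.

End FinitenessOfIntegerPoints.

(** * The semigroup, its lattice, its saturation and its saturation points *)

Section AffineSemigroup.
Variables (R : realType) (d n : nat) (A : 'M[int]_(d, n)).
Implicit Types a b : 'cV[int]_d.

Local Notation Q := (semigroup A).
Local Notation L := (lattice A).
Local Notation K := (gen_cone R A).
Local Notation Qsat := (saturation R A).
Local Notation S := (sat_points R A).

Lemma gen_coneD x y : K x -> K y -> K (x + y).
Proof.
move=> [t t0 ->] [u u0 ->]; exists (fun i => t i + u i) => [i|].
  exact: addr_ge0.
by rewrite -big_split; apply: eq_bigr => i _; rewrite scalerDl.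
Qed.

Lemma gen_coneZ t y : 0 <= t -> K y -> K (t *: y).
Proof.
move=> t0 [u u0 ->]; exists (fun i => t * u i) => [i|]; first exact: mulr_ge0.
by rewrite scaler_sumr; apply: eq_bigr => i _; rewrite scalerA.
Qed.

Lemma convex_cone_gen_cone : convex_cone K.
Proof.
split=> [|x y|t y]; [|exact: gen_coneD|exact: gen_coneZ].
by exists (fun=> 0) => //; rewrite big1 // => i _; rewrite scale0r.
Qed.

Lemma gen_cone_col i : K (embed R (col i A)).
Proof.
exists (fun j => (j == i)%:R) => [j|]; first exact: ler0n.
rewrite (bigD1 i) //= eqxx scale1r big1 ?addr0 // => j /negbTE ->.
by rewrite scale0r.
Qed.

Lemma gen_cone_min C :
  convex_cone C -> (forall i, C (embed R (col i A))) -> K `<=` C.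
Proof.
move=> cC CA y [x x0 ->]; apply: convex_cone_sum => // i _.
by case: cC => _ _; apply.
Qed.

Lemma semigroup0 : Q 0.
Proof. by exists (fun=> 0%N); rewrite big1. Qed.

Lemma semigroupD a b : Q a -> Q b -> Q (a + b).
Proof.
move=> [x ->] [y ->]; exists (fun i => x i + y i)%N.
by rewrite -big_split; apply: eq_bigr => i _; rewrite mulrnDr.
Qed.

Lemma semigroup_col i : Q (col i A).
Proof.
exists (fun j => (j == i) : nat).
by rewrite (bigD1 i) //= eqxx mulr1n big1 ?addr0 // => j /negbTE ->.
Qed.

Lemma semigroupMn a k : Q a -> Q (a *+ k).
Proof.
by move=> [x ->]; exists (fun i => x i * k)%N; rewrite -sumrMnl;
  apply: eq_bigr => i _; rewrite mulrnA.
Qed.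

Lemma semigroup_lattice : Q `<=` L.
Proof. by move=> _ [x ->]; exists (fun i => (x i)%:Z). Qed.

Lemma latticeB a b : L a -> L b -> L (a - b).
Proof.
move=> [x ->] [y ->]; exists (fun i => x i - y i).
by rewrite -sumrB; apply: eq_bigr => i _; rewrite mulrzBr.
Qed.

Lemma latticeD a b : L a -> L b -> L (a + b).
Proof.
move=> La Lb; rewrite -[b]opprK; apply: latticeB => //.
by rewrite -sub0r; apply: latticeB => //; exact/semigroup_lattice/semigroup0.
Qed.

Lemma embed_sumMn (I : finType) (s : I -> 'cV[int]_d) (x : I -> nat) :
  embed R (\sum_i s i *+ x i) = \sum_i (x i)%:R *: embed R (s i).
Proof.
by rewrite raddf_sum; apply: eq_bigr => i _; rewrite raddfMn scaler_nat.
Qed.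

Lemma semigroup_saturation : Q `<=` Qsat.
Proof.
move=> a Qa; split; last exact: semigroup_lattice.
case: Qa => x ->; exists (fun i => (x i)%:R); first by move=> i; exact: ler0n.
exact: embed_sumMn.
Qed.

Lemma saturationD a b : Qsat a -> Qsat b -> Qsat (a + b).
Proof.
move=> [Ka La] [Kb Lb]; split; last exact: latticeD.
by rewrite raddfD; apply: gen_coneD.
Qed.

Lemma sat_points_add_saturation a b : S a -> Qsat b -> Q (a + b).
Proof. by move=> [_ aQ] Qb; apply: aQ; exists b. Qed.

Lemma sat_points_semigroup : S `<=` Q.
Proof. by move=> a []. Qed.

(** [S] is an ideal of [Q], because [b + Qsat] lies in [Qsat]. *)
Lemma sat_pointsD a b : S a -> Q b -> S (a + b).
Proof.
move=> Sa Qb; split; first exact: semigroupD (sat_points_semigroup Sa) Qb.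
move=> _ [c Qc <-]; rewrite -addrA; apply: sat_points_add_saturation => //.
by apply: saturationD => //; exact: semigroup_saturation.
Qed.

Lemma saturated_of_sat_points0 : S 0 -> Qsat `<=` Q.
Proof. by move=> S0 a Qa; rewrite -[a]add0r; apply: sat_points_add_saturation. Qed.

(* Subtracting integer parts of the coefficients moves a point of the
   saturation into a zonotope, which has finitely many lattice points; each of
   them becomes an element of [Q] after adding a large enough common multiple of
   [\sum_i col i A]. *)
Lemma sat_points_nonempty : exists s, S s.
Proof.
have [F Feq] := (finite_seqP _).1 (finite_zonotope R (fun i => col i A)).
(* The premise stays under the quantifier so that [choice] gives a total function; its values matter
   only on [L]. *)
have rep a : exists z : 'I_n -> int, L a -> a = \sum_i col i A *~ z i.
  have [[z az]|nLa] := pselect (L a); first by exists z.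
  by exists (fun=> 0) => La; case: nLa.
have {rep}[z zE] := choice rep.
pose N := (\sum_(f <- F) \sum_i absz (z f i))%N.
have zN f i : f \in F -> 0 <= z f i + N%:Z.
  move=> fF; suff : (absz (z f i) <= N)%N by lia.
  rewrite /N (big_rem f) //= (bigD1 i) //=.
  by rewrite -addnA leq_addr.
pose s : 'cV[int]_d := \sum_i col i A *+ N.
have Qs : Q s by exists (fun=> N).
exists s; split=> // _ [b [[x x0 bE] Lb] <-].
pose q : 'cV[int]_d := \sum_i col i A *+ Num.trunc (x i).
have Qq : Q q by exists (fun i => Num.trunc (x i)).
have bqF : b - q \in F.
  suff : [set` F] (b - q) by [].
  rewrite -Feq; exists (fun i => x i - (Num.trunc (x i))%:R) => [i|].
    have /andP[lei gti] := truncn_itv (x0 i).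
    by rewrite subr_ge0 lei lerBlDl natr1 ltW.
  rewrite raddfB /= bE embed_sumMn -sumrB.
  by apply: eq_bigr => i _; rewrite scalerBl.
rewrite -(subrK q b) addrA; apply: semigroupD => //.
rewrite (zE (b - q)); last exact/latticeB/semigroup_lattice.
exists (fun i => absz (z (b - q) i + N%:Z)); rewrite /s -big_split.
apply: eq_bigr => i _ /=.
by rewrite pmulrn -mulrzDr [in RHS]pmulrn gez0_abs ?zN // addrC.
Qed.

End AffineSemigroup.

(** * Heights in a pointed semigroup, and the cone over its saturation points *)

Section PointedSemigroup.
Variables (R : realType) (d n : nat) (A : 'M[int]_(d, n)).
Implicit Types a b : 'cV[int]_d.

Local Notation Q := (semigroup A).
Local Notation K := (gen_cone R A).
Local Notation Qsat := (saturation R A).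
Local Notation S := (sat_points R A).
Local Notation minS := (min_sat_points R A).
Local Notation e i := (embed R (col i A)).

(** The sum [M] of all inverses [1 / (c . a_i)] is at least each of them, so scaling [c] by [M]
    brings every value up to at least [1]. The value of [w] then serves as a height. *)
Lemma normalized_functional :
  (exists c : 'cV[rat]_d, forall i : 'I_n, 0 < ratdot c (col i A)) ->
  exists w : 'cV[R]_d, forall i, 1 <= dot w (e i).
Proof.
move=> [c c0]; pose M := \sum_i (ratdot c (col i A))^-1.
exists (rat_embed R (M *: c)) => i.
have -> : rat_embed R (M *: c) = ratr M *: rat_embed R c.
  by apply/matrixP => j k; rewrite !mxE rmorphM.
rewrite dotC linearZ /= dotC dot_rat_embed -rmorphM -[1](rmorph1 (@ratr R)).
rewrite ler_rat -ler_pdivrMr // div1r /M (bigD1 i) //= lerDl.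
by apply: sumr_ge0 => j _; rewrite invr_ge0 ltW.
Qed.

Variables (w : 'cV[R]_d) (w_ge1 : forall i, 1 <= dot w (e i)).

(** The other terms only add nonnegative height. Hence bounded height means bounded coefficients,
    and height zero forces them all to vanish. *)
Lemma coef_le_height (x : 'I_n -> R) i :
  (forall j, 0 <= x j) -> x i <= dot w (\sum_j x j *: e j).
Proof.
move=> x0; rewrite raddf_sum (bigD1 i) //= linearZ /= -[x i]addr0 lerD //.
  by rewrite addr0 ler_peMr.
apply: sumr_ge0 => j _; rewrite linearZ /= mulr_ge0 //.
exact: le_trans ler01 (w_ge1 j).
Qed.

Lemma height_ge1 a : Q a -> a != 0 -> 1 <= dot w (embed R a).
Proof.
move=> [x ->] nz; have [i xi] : exists i, x i != 0%N.
  apply: contrapT => /forallNP x0; move/eqP: nz; apply.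
  by rewrite big1 // => i _; have /negP := x0 i; rewrite negbK => /eqP ->.
have := coef_le_height (x := fun i => (x i)%:R) i (fun=> ler0n _ _).
rewrite -embed_sumMn; apply: le_trans.
by rewrite ler1n lt0n.
Qed.

Lemma height_ge0 y : K y -> 0 <= dot w y.
Proof.
move=> [x x0 ->]; rewrite raddf_sum /=; apply: sumr_ge0 => i _.
by rewrite linearZ /= mulr_ge0 // (le_trans ler01).
Qed.

Lemma finite_height_le (M : R) :
  finite_set [set a | Q a /\ dot w (embed R a) <= M].
Proof.
apply: (sub_finite_set _ (finite_combinations A (Num.trunc M).+1)).
move=> _ [[x ->] xM]; exists x => // i.
have xi : (x i)%:R <= M.
  apply: le_trans xM; rewrite embed_sumMn.
  by apply: (coef_le_height (x := fun i => (x i)%:R)) => j; exact: ler0n.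
by rewrite ltnS truncn_ge_nat // (le_trans _ xi).
Qed.

(** Descent on an integer bound for the height: a non-minimal point splits into two saturation
    points, each of height at least [1] since [0] is not in [S], so both parts are lower by at least
    [1]. With [0] in [S], taking [b = 0] would show that no nonzero point is minimal. *)
Lemma sat_points_sub_cone_min :
  ~ S 0 -> embed R @` S `<=` cone (embed R @` minS).
Proof.
move=> nS0 _ [a Sa <-]; have [m] : exists m : nat, dot w (embed R a) < m%:R.
  exists (Num.trunc (dot w (embed R a))).+1.
  by have /andP[] := truncn_itv (height_ge0 (semigroup_saturation R
    (sat_points_semigroup Sa)).1).
elim: m a Sa => [|m IH] a Sa ham.
  have := height_ge0 (semigroup_saturation R (sat_points_semigroup Sa)).1.
  by rewrite leNgt ham.
have [amin|nmin] := pselect (minS a); first by apply: sub_cone; exists a.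
have [b [Sb _ Sab]] : exists b, [/\ S b, b != a & S (a - b)].
  by apply: contrapT => Nb; apply: nmin.
have S_ge1 c : S c -> 1 <= dot w (embed R c).
  move=> Sc; apply: height_ge1 (sat_points_semigroup Sc) _.
  by apply: contra_notN nS0 => /eqP <-.
have hE : dot w (embed R a) = dot w (embed R b) + dot w (embed R (a - b)).
  by rewrite -raddfD -raddfD addrC subrK.
have hb := S_ge1 _ Sb; have hab := S_ge1 _ Sab.
have [_ CD _] := convex_cone_cone (embed R @` minS).
rewrite -(subrK b a) raddfD.
by apply: CD; apply: IH => //; move: ham; rewrite hE -natr1; lra.
Qed.

Lemma gen_coneE : K = cone (embed R @` [set` [seq col i A | i : 'I_n]]).
Proof.
apply/seteqP; split.
  apply: gen_cone_min; first exact: convex_cone_cone.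
  move=> i; apply: sub_cone; exists (col i A) => //=.
  by apply: map_f; rewrite mem_enum.
apply: cone_min; first exact: convex_cone_gen_cone.
by move=> _ [a /mapP[i _ ->] <-]; exact: gen_cone_col.
Qed.

Lemma sat_points_sub_gen_cone : embed R @` S `<=` K.
Proof.
by move=> _ [a /sat_points_semigroup/(semigroup_saturation R)[Ka _] <-].
Qed.

Lemma polyhedral_of_finite_min :
  finite_set minS -> rational_polyhedral_cone (cone (embed R @` S)).
Proof.
move=> /finite_seqP[gs gsE]; have [S0|nS0] := pselect (S 0).
  suff -> : cone (embed R @` S) = K.
    by rewrite gen_coneE; exact: finitely_generated_cone_polyhedral.
  apply/seteqP; split.
    by apply: cone_min sat_points_sub_gen_cone; exact: convex_cone_gen_cone.
  apply: gen_cone_min; first exact: convex_cone_cone.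
  move=> i; apply: sub_cone; exists (col i A) => //.
  by rewrite -[col i A]add0r; apply: sat_pointsD => //; exact: semigroup_col.
suff -> : cone (embed R @` S) = cone (embed R @` [set` gs]).
  exact: finitely_generated_cone_polyhedral.
rewrite -gsE; apply: cone_eq; first exact: sat_points_sub_cone_min.
by move=> _ [a [Sa _] <-]; apply: sub_cone; exists a.
Qed.

Lemma gen_cone_sub_cone_sat_points :
  rational_polyhedral_cone (cone (embed R @` S)) -> K `<=` cone (embed R @` S).
Proof.
move=> [m [B BE]]; apply: gen_cone_min; first exact: convex_cone_cone.
move=> i; have [s Ss] := sat_points_nonempty R A.
have line k : cone (embed R @` S) (embed R s + k%:R *: e i).
  apply: sub_cone; exists (s + col i A *+ k).
    by apply: sat_pointsD => //; apply/semigroupMn/semigroup_col.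
  by rewrite raddfD raddfMn scaler_nat.
move: line; rewrite BE => /= line j.
pose f (y : 'cV[R]_d) := \sum_k ratr (B j k) * y k 0.
have fE (t : R) x y : f (x + t *: y) = f x + t * f y.
  rewrite /f mulr_sumr -big_split; apply: eq_bigr => k _ /=.
  by rewrite !mxE mulrDr mulrCA.
have fline k : 0 <= f (embed R s) + k%:R * f (e i) by rewrite -fE; exact: line.
rewrite -/(f (e i)) leNgt; apply/negP => neg.
(* For an integer [k] above [q], the inequality [f] would fail at [s + k a_i]. *)
pose q := f (embed R s) / - f (e i).
have q0 : 0 <= q.
  rewrite divr_ge0 // ?oppr_ge0 ?(ltW neg) //.
  by have := fline 0%N; rewrite mul0r addr0.
have /andP[_] := truncn_itv q0.
rewrite ltr_pdivrMr ?oppr_gt0 // mulrN -subr_lt0 opprK.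
by rewrite ltNge fline.
Qed.

(** A vector spanning the ray is a nonnegative combination of points of [S]. Splitting off one
    nonzero term, the face property puts that term on the ray, and dividing by its coefficient
    leaves a point of [S] there. *)
Lemma sat_point_on_extreme_ray :
  rational_polyhedral_cone (cone (embed R @` S)) ->
  forall r, extreme_ray K r -> exists2 s, S s & r (embed R s).
Proof.
move=> /gen_cone_sub_cone_sat_points KS r [[v v0 rE] rK face].
have rv : r v by rewrite rE; exists 1; rewrite /= ?ler01 ?scale1r.
have [m [x [t [Sx t0 vE]]]] := KS _ (rK _ rv).
have [j xj] : exists j, t j *: x j != 0.
  apply: contrapT => /forallNP x0; move/eqP: v0; apply.
  by rewrite vE big1 // => i _; have /negP := x0 i; rewrite negbK => /eqP.
have Ktx i : K (t i *: x i).
  by apply: gen_coneZ => //; apply/sat_points_sub_gen_cone/Sx.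
have [] := face (t j *: x j) (\sum_(i < m | i != j) t i *: x i) (Ktx j).
- by apply: convex_cone_sum => //; exact: convex_cone_gen_cone.
- by move: rv; rewrite {1}vE (bigD1 j).
move=> + _; rewrite rE => -[u u0 uv].
have [s Ss sE] := Sx j; exists s => //; rewrite sE.
have tj : t j != 0 by apply: contraNneq xj => ->; rewrite scale0r.
exists ((t j)^-1 * u); first by rewrite /= mulr_ge0 // invr_ge0.
by rewrite -scalerA uv scalerA mulVf // scale1r.
Qed.

(** * Irredundant generators of [K] and its extreme rays *)

Definition subcone (J : {set 'I_n}) : set 'cV[R]_d :=
  [set y | exists2 x : 'I_n -> R,
     forall i, 0 <= x i /\ (i \notin J -> x i = 0) & y = \sum_i x i *: e i].

Lemma convex_cone_subcone J : convex_cone (subcone J).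
Proof.
split.
- by exists (fun=> 0) => //; rewrite big1 // => i _; rewrite scale0r.
- move=> _ _ [t t0 ->] [u u0 ->]; exists (fun i => t i + u i) => [i|].
    have [ti tJ] := t0 i; have [ui uJ] := u0 i; split; first exact: addr_ge0.
    by move=> iJ; rewrite tJ // uJ // addr0.
  by rewrite -big_split; apply: eq_bigr => i _; rewrite scalerDl.
- move=> t _ t0 [u u0 ->]; exists (fun i => t * u i) => [i|].
    have [ui uJ] := u0 i; split; first exact: mulr_ge0.
    by move=> iJ; rewrite uJ // mulr0.
  by rewrite scaler_sumr; apply: eq_bigr => i _; rewrite scalerA.
Qed.

Lemma subcone_col (J : {set 'I_n}) i : i \in J -> subcone J (e i).
Proof.
move=> iJ; exists (fun j => (j == i)%:R) => [j|].
  split; first exact: ler0n.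
  by case: eqP => // ->; rewrite iJ.
rewrite (bigD1 i) //= eqxx scale1r big1 ?addr0 // => j /negbTE ->.
by rewrite scale0r.
Qed.

Lemma subcone_min (J : {set 'I_n}) C :
  convex_cone C -> (forall i, i \in J -> C (e i)) -> subcone J `<=` C.
Proof.
move=> cC CJ _ [x x0 ->]; have [C0 _ CZ] := cC; apply: convex_cone_sum => // i _.
have [xi xJ] := x0 i; have [iJ|iJ] := boolP (i \in J).
  by apply: CZ => //; exact: CJ.
by rewrite xJ // scale0r.
Qed.

(** Irredundant generators replace an enumeration of the extreme rays: each of them will be shown to
    span one. *)
Definition minimal_generators (J : {set 'I_n}) : Prop :=
  K `<=` subcone J /\ forall j, j \in J -> ~ subcone (J :\ j) (e j).

(** Take [J] minimal for inclusion among the generating subsets; a redundant [j] could be dropped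
    from it. *)
Lemma minimal_generators_exists : exists J, minimal_generators J.
Proof.
have [J /minsetP[/asboolP KJ Jmin]] :
    {J | minset (fun J : {set 'I_n} => `[< K `<=` subcone J >]) J}.
  apply: ex_minset; exists [set: 'I_n]%SET; apply/asboolP => _ [x x0 ->].
  by exists x => // i; rewrite finset.in_setT.
exists J; split=> // j jJ Hj.
have : j \in J :\ j; last by rewrite !inE eqxx.
rewrite (Jmin (J :\ j)) ?subD1set //; apply/asboolP.
apply: (subset_trans KJ); apply: subcone_min; first exact: convex_cone_subcone.
move=> i iJ; have [->//|ij] := eqVneq i j.
by apply: subcone_col; rewrite !inE ij.
Qed.

(** Write [x + y = t e_j] with coefficients [z] on [J] and compare [z j] with [t]: irredundance
    excludes [z j < t], and otherwise pointedness kills all the other coefficients. *)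
Lemma extreme_ray_minimal_generator J j :
  minimal_generators J -> j \in J -> extreme_ray K (ray (e j)).
Proof.
move=> [KJ Jmin] jJ; have cJj := convex_cone_subcone (J :\ j).
have [_ _ Jj_scale] := cJj; split.
- exists (e j) => //; apply/eqP => ej0; have := w_ge1 j.
  by rewrite ej0 raddf0 ler10.
- by move=> _ [t t0 <-]; apply: gen_coneZ => //; exact: gen_cone_col.
move=> x y /KJ[u u0 xE] /KJ[v v0 yE] [t t0 xyE].
pose z i := u i + v i.
have z0 i : 0 <= z i by have [? _] := u0 i; have [? _] := v0 i; exact: addr_ge0.
have zE : t *: e j = \sum_i z i *: e i.
  by rewrite xyE xE yE -big_split; apply: eq_bigr => i _; rewrite scalerDl.
have [zjt|tzj] := ltP (z j) t.
  (* Moving [z j] to the left leaves a positive multiple of [e j] as a combination of the other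
     generators. *)
  case: (Jmin _ jJ).
  have -> : e j = (t - z j)^-1 *: \sum_(i | i != j) z i *: e i.
    apply: (scalerI (_ : t - z j != 0)); first by rewrite subr_eq0 gt_eqF.
    rewrite scalerA divff ?subr_eq0 ?gt_eqF // scale1r scalerBl zE (bigD1 j) //=.
    by rewrite addrAC subrr add0r.
  apply: (Jj_scale); first by rewrite invr_ge0 subr_ge0 ltW.
  apply: convex_cone_sum => // i ij; have [iJ|iJ] := boolP (i \in J).
    by apply: Jj_scale => //; apply: subcone_col; rewrite !inE ij.
  have [_ uJ] := u0 i; have [_ vJ] := v0 i.
  by rewrite /z uJ // vJ // addr0 scale0r; case: cJj.
(* Subtracting [t] from [z j] gives a nonnegative combination equal to [0], hence of height zero. *)
have zij i : i != j -> z i = 0.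
  move=> ij; apply/eqP; rewrite eq_le z0 andbT.
  have := @coef_le_height (fun k => z k - t *+ (k == j)) i.
  rewrite (negbTE ij) mulr0n subr0.
  have -> : \sum_k (z k - t *+ (k == j)) *: e k = 0.
    rewrite -[RHS](subrr (t *: e j)) {1}zE (bigD1 j) //= [in RHS](bigD1 j) //=.
    rewrite eqxx mulr1n scalerBl addrAC; congr (_ + _ - _).
    by apply: eq_bigr => k /negbTE ->; rewrite mulr0n subr0.
  rewrite raddf0; apply => k.
  by have [->|_] := eqVneq k j; rewrite ?mulr1n ?mulr0n ?subr0 ?subr_ge0.
have uij i : i != j -> u i = 0 /\ v i = 0.
  move=> /zij/eqP; have [ui _] := u0 i; have [vi _] := v0 i.
  by rewrite paddr_eq0 // => /andP[/eqP ? /eqP ?].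
split.
  exists (u j); first by have [] := u0 j.
  by rewrite xE (bigD1 j) //= big1 ?addr0 // => i /uij[-> _]; rewrite scale0r.
exists (v j); first by have [] := v0 j.
by rewrite yE (bigD1 j) //= big1 ?addr0 // => i /uij[_ ->]; rewrite scale0r.
Qed.

(** * Finiteness of the holes, the non-saturation points and the minimal points *)

Lemma finite_holes_of_extreme_rays :
  (forall r, extreme_ray K r -> exists2 s, S s & r (embed R s)) ->
  finite_set (holes R A).
Proof.
(* Every ray contains the origin, so the hypothesis yields usable generators only when [0] is not in
   [S]; if it is, there are no holes. *)
move=> Sext; have [S0|nS0] := pselect (S 0).
  suff -> : holes R A = set0 by [].
  by apply/seteqP; split=> // a [/(saturated_of_sat_points0 S0)].
have [J Jgen] := minimal_generators_exists.
have pick j : exists st : 'cV[int]_d * R,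
    j \in J -> [/\ S st.1, 0 < st.2 & embed R st.1 = st.2 *: e j].
  have [jJ|_] := boolP (j \in J); last by exists (0, 0).
  have [s Ss [t t0 sE]] := Sext _ (extreme_ray_minimal_generator Jgen jJ).
  exists (s, t) => _; split=> //=; rewrite lt_def t0 andbT.
  apply: contra_notN nS0 => /eqP t00.
  by move: sE; rewrite t00 scale0r => /esym/eqP; rewrite embed_eq0 => /eqP <-.
have {pick}[st stP] := choice pick.
apply: (sub_finite_set _ (finite_zonotope R (fun j => (st j).1))).
move=> a [[Ka La] nQa]; have [u u0 aE] := Jgen.1 _ Ka.
(* Off [J] the pair [st j] is arbitrary, but [u j] vanishes there. *)
have uE j : u j *: e j = (u j / (st j).2) *: embed R (st j).1.
  have [_ uJ] := u0 j; have [/stP[_ t0 ->]|/uJ ->] := boolP (j \in J).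
    by rewrite scalerA divfK // gt_eqF.
  by rewrite mul0r !scale0r.
exists (fun j => u j / (st j).2) => [j|]; last by rewrite aE; apply: eq_bigr.
have [uj uJ] := u0 j; have [/stP[Ss t0 sE]|/uJ ->] := boolP (j \in J); last first.
  by rewrite mul0r lexx ler01.
rewrite divr_ge0 ?(ltW t0) //= ler_pdivrMr // mul1r leNgt; apply/negP => tu.
apply: nQa; rewrite -(subrK (st j).1 a) addrC.
apply: (sat_points_add_saturation Ss) => //.
split; last first.
  by apply: latticeB => //; exact: semigroup_lattice (sat_points_semigroup Ss).
(* The chosen point is a multiple of [e j], so subtracting it changes only the coefficient at [j],
   which stays positive by [tu]. *)
exists (fun i => u i - (st j).2 *+ (i == j)) => [i|].
  have [->|_] := eqVneq i j; rewrite ?mulr1n ?mulr0n ?subr0 ?subr_ge0 ?(ltW tu) //.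
  by case: (u0 i).
rewrite raddfB /= aE sE (bigD1 j) //= [RHS](bigD1 j) //= eqxx mulr1n scalerBl.
rewrite addrAC; congr (_ + _).
by apply: eq_bigr => k /negbTE ->; rewrite mulr0n subr0.
Qed.

Lemma finite_nonsat_of_finite_holes :
  finite_set (holes R A) -> finite_set (nonsat_points R A).
Proof.
move=> /finite_seqP[hs hsE]; pose M := \sum_(b <- hs) `|dot w (embed R b)|.
apply: (sub_finite_set _ (finite_height_le M)) => a [Qa nSa]; split=> //.
have [b Qb nQab] : exists2 b, Qsat b & ~ Q (a + b).
  apply: contrapT => Nb; apply: nSa; split=> // _ [b Qb <-].
  by apply: contrapT => nQ; apply: Nb; exists b.
have abhs : a + b \in hs.
  suff : [set` hs] (a + b) by [].
  rewrite -hsE; split=> //; apply: saturationD => //; exact: semigroup_saturation.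
apply: (@le_trans _ _ `|dot w (embed R (a + b))|).
  by rewrite !raddfD /= (le_trans _ (ler_norm _)) // lerDl height_ge0 //; case: Qb.
by rewrite /M (big_rem _ abhs) /= lerDl sumr_ge0.
Qed.

Lemma finite_min_of_finite_nonsat :
  finite_set (nonsat_points R A) -> finite_set minS.
Proof.
move=> finN.
(* Otherwise all multiples of the column, distinct because its height is positive, would be
   non-saturation points. *)
have mult i : exists m, S (col i A *+ m).
  apply: contrapT => /forallNP nS; apply: infinite_nat.
  have col_inj : injective (fun k => col i A *+ k).
    move=> k l /= /(congr1 (dot w \o @embed R d)) /=; rewrite !raddfMn /= => kl.
    apply: (mulrIn (x := dot w (e i))) => //.
    by apply: lt0r_neq0; exact: lt_le_trans ltr01 (w_ge1 i).
  apply: (sub_finite_set _ (finite_preimage (in2W col_inj) finN)) => k _.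
  by split; [exact/semigroupMn/semigroup_col | exact: nS].
have {mult}[m mS] := choice mult.
pose box := [set a : 'cV[int]_d | exists2 x : 'I_n -> nat,
  forall i, (x i < (\max_j m j).+1)%N & a = \sum_i col i A *+ x i].
(* The added [0] accounts for a minimal point equal to [m_i a_i] itself. *)
pose shifts := [set col i A *+ m i + b |
  i in [set: 'I_n] & b in 0 |` nonsat_points R A].
apply: (@sub_finite_set _ _ (box `|` shifts)); last first.
  rewrite finite_setU; split; first exact: finite_combinations.
  by apply: finite_image2 => //; rewrite finite_setU.
move=> a [Sa amin]; have [x aE] := sat_points_semigroup Sa.
have [small|/existsNP[i /negP]] := pselect (forall i, (x i <= \max_j m j)%N).
  by left; exists x.
rewrite -ltnNge => big; right; exists i => //.
have mx : (m i <= x i)%N by apply: leq_trans (ltnW big); exact: leq_bigmax.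
exists (a - col i A *+ m i); last by rewrite addrC subrK.
have [<-|ne] := eqVneq (col i A *+ m i) a; first by left; rewrite subrr.
(* The difference lies in [Q] because [m i <= x i], and not in [S], since [m_i a_i] would then
   contradict the minimality of [a]. *)
right; split; last by move=> Sb; apply: amin; exists (col i A *+ m i).
exists (fun j => x j - (if j == i then m i else 0))%N.
rewrite aE (bigD1 i) //= [RHS](bigD1 i) //= eqxx mulrnBr // addrAC.
by congr +%R; apply: eq_bigr => j /negbTE ->; rewrite subn0.
Qed.

End PointedSemigroup.

Theorem theorem2p5 (R : realType) (d n : nat) (A : 'M[int]_(d, n))
  (Apos : exists c : 'cV[rat]_d, forall i : 'I_n, 0 < ratdot c (col i A)) :
  [<-> finite_set (min_sat_points R A);
       rational_polyhedral_cone (cone (embed R @` sat_points R A));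
       forall r : set 'cV[R]_d, extreme_ray (gen_cone R A) r ->
         exists2 s : 'cV[int]_d, sat_points R A s & r (embed R s);
       finite_set (holes R A);
       finite_set (nonsat_points R A)].
Proof.
have [w w_ge1] := normalized_functional R Apos.
tfae.
- exact: polyhedral_of_finite_min w_ge1.
- exact: sat_point_on_extreme_ray.
- exact: finite_holes_of_extreme_rays w_ge1.
- exact: finite_nonsat_of_finite_holes w_ge1.
- exact: finite_min_of_finite_nonsat w_ge1.
Qed.
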